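(* Let $\mathbf D$ be a subdirect product of finitely many $2$-element algebras each of which is polynomially equivalent to the $2$-element lattice. Then $\mathrm{CSAT}(\mathbf D)$ is solvable in polynomial time.
   Context: An algebra is polynomially equivalent to the $2$-element lattice if it has universe $\{0,1\}$ and the same polynomial operations (operations built from fundamental operations, projections and constants) as $(\{0,1\},\wedge,\vee)$. A circuit over $\mathbf D$ is a directed acyclic graph whose input nodes are labelled by variables or constants from $D$ and whose gates are labelled by fundamental operations of $\mathbf D$; size = size of the graph. $\mathrm{CSAT}(\mathbf D)$: given such a circuit with two output gates $g_1,g_2$, decide whether there is an input tuple $\bar a$ with $g_1(\bar a)=g_2(\bar a)$; running time measured in the circuit size. *)

(* Defs.v *)
From mathcomp Require Import all_boot.
Set Implicit Arguments.
Unset Strict Implicit.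
Unset Printing Implicit Defensive.

Definition bool_ops (m : nat) (ar : 'I_m -> nat) :=
  forall j : 'I_m, ('I_(ar j) -> bool) -> bool.

Inductive pterm (m : nat) (ar : 'I_m -> nat) (n : nat) : Type :=
| PVar of 'I_n
| PConst of bool
| POp (j : 'I_m) of ('I_(ar j) -> pterm ar n).

Fixpoint peval (m : nat) (ar : 'I_m -> nat) (ops : bool_ops ar) (n : nat)
  (t : pterm ar n) (x : 'I_n -> bool) : bool :=
  match t with
  | PVar i => x i
  | PConst b => b
  | POp j args => ops j (fun l => peval ops (args l) x)
  end.

Definition is_poly (m : nat) (ar : 'I_m -> nat) (ops : bool_ops ar) (n : nat)
  (f : ('I_n -> bool) -> bool) : Prop :=
  exists t : pterm ar n, forall x, peval ops t x = f x.

Definition lat_ar : 'I_2 -> nat := fun _ => 2.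
Definition lat_ops : bool_ops lat_ar :=
  fun j x => if nat_of_ord j == 0 then x ord0 && x (lift ord0 ord0)
             else x ord0 || x (lift ord0 ord0).

Definition poly_equiv_lattice (m : nat) (ar : 'I_m -> nat) (ops : bool_ops ar) :
  Prop :=
  forall (n : nat) (f : ('I_n -> bool) -> bool), is_poly ops f <-> is_poly lat_ops f.

Definition prod_op (k m : nat) (ar : 'I_m -> nat) (A : 'I_k -> bool_ops ar)
  (j : 'I_m) (xs : 'I_(ar j) -> {ffun 'I_k -> bool}) : {ffun 'I_k -> bool} :=
  [ffun i => A i j (fun l => xs l i)].
Arguments prod_op {k m ar} A j xs.

Definition subdirect (k m : nat) (ar : 'I_m -> nat) (A : 'I_k -> bool_ops ar)
  (D : {set {ffun 'I_k -> bool}}) : Prop :=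
  [/\ D != set0,
      (forall (j : 'I_m) (xs : 'I_(ar j) -> {ffun 'I_k -> bool}),
          (forall l, xs l \in D) -> prod_op A j xs \in D)
    & (forall (i : 'I_k) (b : bool), exists2 d, d \in D & d i = b)].

(* A circuit is a list of nodes in topological order; node p is either *)
(* an input node labelled by a variable x_i or a constant of D, or a   *)
(* gate labelled by an operation symbol j whose (ar j) arguments are   *)
(* indices of earlier nodes; plus two output nodes.                    *)

Inductive node (k m : nat) : Type :=
| NVar of nat
| NConst of {ffun 'I_k -> bool}
| NOp of 'I_m & seq nat.

Record circuit (k m : nat) : Type := Circuit {
  c_nodes : seq (node k m);
  c_out1 : nat;
  c_out2 : nat }.

(* size of the underlying graph = #nodes + #edges *)
Definition csize (k m : nat) (C : circuit k m) : nat :=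
  size (c_nodes C) +
  sumn [seq (if nd is NOp _ args then size args else 0) | nd <- c_nodes C].

(* Well-formedness w.r.t. the algebra (signature ar, universe D).
   Variables are named x_0, x_1, ... with indices < number of nodes
   (canonical naming; any circuit can be renamed this way). *)
Definition node_wf (k m : nat) (ar : 'I_m -> nat) (D : {set {ffun 'I_k -> bool}})
  (nnodes p : nat) (nd : node k m) : bool :=
  match nd with
  | NVar i => i < nnodes
  | NConst d => d \in D
  | NOp j args => (size args == ar j) && all (fun q => q < p) args
  end.

Definition circuit_wf (k m : nat) (ar : 'I_m -> nat) (D : {set {ffun 'I_k -> bool}})
  (C : circuit k m) : bool :=
  [&& all (fun p => node_wf ar D (size (c_nodes C)) p
                      (nth (NVar k m 0) (c_nodes C) p))
          (iota 0 (size (c_nodes C))),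
      c_out1 C < size (c_nodes C) & c_out2 C < size (c_nodes C)].

Definition dflt (k : nat) : {ffun 'I_k -> bool} := [ffun _ => false].

Definition eval_node (k m : nat) (ar : 'I_m -> nat) (A : 'I_k -> bool_ops ar)
  (a : nat -> {ffun 'I_k -> bool}) (vs : seq {ffun 'I_k -> bool}) (nd : node k m)
  : {ffun 'I_k -> bool} :=
  match nd with
  | NVar i => a i
  | NConst d => d
  | NOp j args => prod_op A j (fun l : 'I_(ar j) => nth (dflt k) vs (nth 0 args l))
  end.

Definition node_values (k m : nat) (ar : 'I_m -> nat) (A : 'I_k -> bool_ops ar)
  (a : nat -> {ffun 'I_k -> bool}) (C : circuit k m) : seq {ffun 'I_k -> bool} :=
  foldl (fun vs nd => rcons vs (eval_node A a vs nd)) [::] (c_nodes C).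

Definition csat_yes (k m : nat) (ar : 'I_m -> nat) (A : 'I_k -> bool_ops ar)
  (D : {set {ffun 'I_k -> bool}}) (C : circuit k m) : Prop :=
  exists a : nat -> {ffun 'I_k -> bool},
    (forall v, a v \in D) /\
    nth (dflt k) (node_values A a C) (c_out1 C) =
    nth (dflt k) (node_values A a C) (c_out2 C).

Definition enc_nat (n : nat) : seq bool := rcons (nseq n true) false.

Definition enc_elt (k : nat) (d : {ffun 'I_k -> bool}) : seq bool :=
  [seq d i | i <- enum 'I_k].

Definition enc_node (k m : nat) (nd : node k m) : seq bool :=
  match nd with
  | NVar i => enc_nat 0 ++ enc_nat i
  | NConst d => enc_nat 1 ++ enc_elt d
  | NOp j args => enc_nat 2 ++ enc_nat j ++ enc_nat (size args)
                  ++ flatten [seq enc_nat q | q <- args]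
  end.

Definition enc_circuit (k m : nat) (C : circuit k m) : seq bool :=
  enc_nat (size (c_nodes C)) ++ flatten [seq enc_node nd | nd <- c_nodes C]
  ++ enc_nat (c_out1 C) ++ enc_nat (c_out2 C).

Inductive move := MoveL | MoveN | MoveR.

Record TM (Sigma : finType) := {
  tm_state : finType;
  tm_work : finType;
  tm_start : tm_state;
  tm_acc : tm_state;
  tm_rej : tm_state;
  tm_delta : tm_state -> option (Sigma + tm_work) ->
             tm_state * option (Sigma + tm_work) * move }.
(* tape symbol None = blank *)
Arguments tm_start {Sigma} t.
Arguments tm_acc {Sigma} t.
Arguments tm_rej {Sigma} t.
Arguments tm_delta {Sigma} t _ _.

Section TMRun.
Variables (Sigma : finType) (M : TM Sigma).
Definition tsym := option (Sigma + tm_work M)%type.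

(* configuration: state, reversed left part, scanned cell, right part *)
Definition config := (tm_state M * (seq tsym * tsym * seq tsym))%type.

Definition tm_step (c : config) : config :=
  let: (q, (ls, cur, rs)) := c in
  if (q == tm_acc M) || (q == tm_rej M) then c else
  let: (q', w, mv) := tm_delta M q cur in
  match mv with
  | MoveN => (q', (ls, w, rs))
  | MoveR => match rs with
             | [::] => (q', (w :: ls, None, [::]))
             | s :: rs' => (q', (w :: ls, s, rs'))
             end
  | MoveL => match ls with
             | [::] => (q', ([::], w, rs))
             | s :: ls' => (q', (ls', s, w :: rs))
             end
  end.

Definition tm_init (w : seq Sigma) : config :=
  match w with
  | [::] => (tm_start M, ([::], None, [::]))
  | x :: w' => (tm_start M, ([::], Some (inl x), [seq Some (inl y) | y <- w']))
  end.

Definition state_after (w : seq Sigma) (t : nat) : tm_state M :=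
  (iter t tm_step (tm_init w)).1.

Definition accepts_within (w : seq Sigma) (t : nat) : bool :=
  state_after w t == tm_acc M.
Definition rejects_within (w : seq Sigma) (t : nat) : bool :=
  state_after w t == tm_rej M.
End TMRun.

Definition CSAT_in_P (k m : nat) (ar : 'I_m -> nat) (A : 'I_k -> bool_ops ar)
  (D : {set {ffun 'I_k -> bool}}) : Prop :=
  exists (M : TM bool) (c e : nat),
    tm_acc M != tm_rej M /\
    forall C : circuit k m, circuit_wf ar D C ->
      let t := c * (csize C).+1 ^ e in
      (csat_yes A D C -> accepts_within M (enc_circuit C) t) /\
      (~ csat_yes A D C -> rejects_within M (enc_circuit C) t).

(* Main.v *)
From HB Require Import structures.
Require Import Defs.
From mathcomp Require Import all_boot zify.
Set Implicit Arguments.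
Unset Strict Implicit.
Unset Printing Implicit Defensive.

(** All operations of [D] are coordinatewise monotone, so if [f(a) = g(a) = d] then
    also [f(d, ..., d) = g(d, ..., d) = d]: it suffices to test the constant
    assignments with values in [D], a number of tests independent of the circuit.
    A Turing machine performs all of them at once, the value of a node being a table
    indexed by the assignments, hence a single tape symbol. It only ever sweeps the
    tape from left to right with a letter-to-letter automaton. The first sweeps count
    the nodes off the header and mark them one by one, which separates the nodes from
    the output numerals. Afterwards sweep number [t] computes the value of node [t]
    and broadcasts it to the right, decrementing every unary reference it meets; a
    reference that is already zero points to node [t] and is replaced by the value.
    A circuit with [N] nodes takes [2N + 1] sweeps. *)

(** * Machines that sweep their tape *)

Section Mealy.
Variables (S G : Type) (delta : S -> G -> S * G).

Fixpoint mealy (s : S) (w : seq G) : S * seq G :=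
  if w is x :: w' then
    let: (s1, y) := delta s x in let: (s2, w2) := mealy s1 w' in (s2, y :: w2)
  else (s, [::]).

Lemma mealy_cat s s1 s2 u u' v v' :
  mealy s u = (s1, u') -> mealy s1 v = (s2, v') -> mealy s (u ++ v) = (s2, u' ++ v').
Proof.
elim: u s u' => [|x u IH] s u' /=; first by move=> [-> <-].
case: (delta s x) => s3 y; case E: (mealy s3 u) => [s4 w4] [Es <-] Hv.
by rewrite (IH s3 w4) // E Es.
Qed.

Lemma mealy_cons s s1 s2 x y w w' :
  delta s x = (s1, y) -> mealy s1 w = (s2, w') -> mealy s (x :: w) = (s2, y :: w').
Proof. by move=> /= -> ->. Qed.

Lemma mealy_nseq s x y n : delta s x = (s, y) -> mealy s (nseq n x) = (s, nseq n y).
Proof. by move=> Hd; elim: n => //= n IH; rewrite Hd IH. Qed.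


Lemma mealy_nseq_cat s s2 x y n v v' : delta s x = (s, y) ->
  mealy s v = (s2, v') -> mealy s (nseq n x ++ v) = (s2, nseq n y ++ v').
Proof. by move=> Hd; apply: mealy_cat; apply: mealy_nseq. Qed.

Lemma size_mealy s w : size (mealy s w).2 = size w.
Proof.
elim: w s => //= x w IH s; case: (delta s x) => s1 y.
by case E: (mealy s1 w) => [s2 w2] /=; rewrite -(IH s1) E.
Qed.

Variables (s0 : S) (verdict : S -> option bool).

(** The index counts the sweeps before the deciding one: index [n] means [n + 1] sweeps, each
    restarted in [s0]. *)
Inductive sweeps_to : nat -> seq G -> bool -> Prop :=
| Sweeps_end w b : verdict (mealy s0 w).1 = Some b -> sweeps_to 0 w b
| Sweeps_next n w s w' b : mealy s0 w = (s, w') -> verdict s = None ->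
    sweeps_to n w' b -> sweeps_to n.+1 w b.

End Mealy.

(** * Repeated sweeps on a one-tape Turing machine *)

Section SweepTM.
Variables (S G : finType) (delta : S -> G -> S * G) (s0 : S).
Variables (emb : bool -> G) (verdict : S -> option bool).

Definition letter_of (x : bool + (bool * G)) : G :=
  match x with inl b => emb b | inr (_, g) => g end.

(* [inl s]: sweeping right; [inr None]: at the left end, about to sweep;
   [inr (Some None)]: returning to the left end; [inr (Some (Some b))]: halted.
   The boolean in a work symbol marks the leftmost cell. *)
Definition sweep_delta (q : S + option (option bool)) (x : option (bool + (bool * G)))
  : (S + option (option bool)) * option (bool + (bool * G)) * move :=
  match q, x with
  | inr None, Some c =>
      let: (s, g) := delta s0 (letter_of c) in (inl s, Some (inr (true, g)), MoveR)
  | inl s, Some c =>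
      let: (s', g) := delta s (letter_of c) in (inl s', Some (inr (false, g)), MoveR)
  | inl s, None =>
      if verdict s is Some b then (inr (Some (Some b)), None, MoveN)
      else (inr (Some None), None, MoveL)
  | inr (Some None), Some (inr (true, _)) => (inr None, x, MoveN)
  | inr (Some None), _ => (q, x, MoveL)
  | _, _ => (q, x, MoveN)
  end.

Definition sweepTM : TM bool :=
  @Build_TM bool (S + option (option bool))%type (bool * G)%type
    (inr None) (inr (Some (Some true))) (inr (Some (Some false))) sweep_delta.

Local Notation step := (@tm_step bool sweepTM).
Local Notation cell := (tsym sweepTM).
Local Notation inner := (fun g : G => Some (inr (false, g)) : cell).

(** [tail] is empty in the first sweep; later it holds the one blank on which the machine turned
    round. *)
Definition scan (ls : seq cell) (cs : seq (bool + (bool * G))) (tail : seq cell)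
  : seq cell * cell * seq cell :=
  if cs is c :: cs' then (ls, Some c, [seq Some x | x <- cs'] ++ tail)
  else (ls, None, [::]).

Lemma step_sweep s ls c cs tail : tail = [::] \/ tail = [:: None] ->
  step (inl s, scan ls (c :: cs) tail) =
  (inl (delta s (letter_of c)).1,
   scan (inner (delta s (letter_of c)).2 :: ls) cs tail).
Proof.
move=> Ht; rewrite /tm_step /=; case: (delta s _) => s' g /=.
by case: cs => [|c' cs] //=; case: Ht => ->.
Qed.

Lemma steps_sweep cs s ls tail : tail = [::] \/ tail = [:: None] ->
  let: (s', w') := mealy delta s (map letter_of cs) in
  iter (size cs) step (inl s, scan ls cs tail) =
  (inl s', (rev (map inner w') ++ ls, None, [::])).
Proof.
move=> Ht; elim: cs s ls => [|c cs IH] s ls //.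
rewrite [mealy _ _ _]/= [size _]/= iterSr step_sweep //.
case: (delta s _) => s1 g /=; have := IH s1 (inner g :: ls).
case: (mealy _ _ _) => s2 w2 ->.
by rewrite /= rev_cons cat_rcons.
Qed.

Lemma steps_back ws g0 c ls rs : c :: ls = map inner ws ++ [:: Some (inr (true, g0))] ->
  iter (size ws) step (inr (Some None) : tm_state sweepTM, (ls, c, rs)) =
  (inr (Some None), ([::], Some (inr (true, g0)), rev (map inner ws) ++ rs)).
Proof.
elim: ws c ls rs => [|g ws IH] c ls rs; first by move=> [-> ->].
rewrite [size _]/= iterSr /= => -[-> ->] /=.
case E: (map inner ws ++ _) => [|c1 l1]; first by case: (ws) E.
by rewrite (IH c1 l1) // rev_cons cat_rcons.
Qed.


Lemma steps_first c cs tail s' g w' :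
  tail = [::] \/ tail = [:: None] ->
  mealy delta s0 (map letter_of (c :: cs)) = (s', g :: w') ->
  iter (size cs).+1 step (inr None : tm_state sweepTM, scan [::] (c :: cs) tail) =
  (inl s', (rev (map inner w') ++ [:: Some (inr (true, g))], None, [::])).
Proof.
move=> Ht; rewrite iterSr /=; case: (delta s0 _) => s1 g1 /=.
have := steps_sweep cs s1 [:: Some (inr (true, g1))] Ht.
case: (mealy _ _ _) => s2 w2 Hi [<- <- <-]; rewrite -Hi; congr iter.
by case: cs {Hi} => [|c' cs] //=; case: Ht => ->.
Qed.

Lemma steps_round c cs tail s' g w' :
  tail = [::] \/ tail = [:: None] ->
  mealy delta s0 (map letter_of (c :: cs)) = (s', g :: w') -> verdict s' = None ->
  iter (2 * size cs + 3) step (inr None : tm_state sweepTM, scan [::] (c :: cs) tail) =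
  (inr None, scan [::] (inr (true, g) :: [seq inr (false, x) | x <- w']) [:: None]).
Proof.
move=> Ht Hm Hv.
have Hs : size w' = size cs.
  by have := size_mealy delta s0 (map letter_of (c :: cs)); rewrite Hm /= size_map => -[].
(* Read from right to left: the pass to the right, the turn at the blank, the way back, and the step
   that recognises the marked cell. *)
have -> : 2 * size cs + 3 = (1 + (size (rev w') + 1)) + (size cs).+1.
  by rewrite size_rev Hs; lia.
rewrite iterD (steps_first Ht Hm) iterD iterD [iter 1 step _]/= Hv.
case E: (rev _ ++ _) => [|c1 l1]; first by case: (rev _) E.
rewrite (@steps_back (rev w') g); last by rewrite map_rev E.
by rewrite /= map_rev revK -map_comp.
Qed.

Lemma steps_end c cs tail b :
  tail = [::] \/ tail = [:: None] ->
  verdict (mealy delta s0 (map letter_of (c :: cs))).1 = Some b ->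
  (iter (size cs).+2 step (inr None : tm_state sweepTM, scan [::] (c :: cs) tail)).1 =
  inr (Some (Some b)).
Proof.
move=> Ht; case E: (mealy _ _ _) => [s' [|g w']].
  by have := size_mealy delta s0 (map letter_of (c :: cs)); rewrite E.
by rewrite iterS (steps_first Ht E) /= => ->.
Qed.

Lemma halted_iter (cf : config sweepTM) b n : cf.1 = inr (Some (Some b)) ->
  (iter n step cf).1 = inr (Some (Some b)).
Proof.
move=> H; suff -> : iter n step cf = cf by [].
elim: n => //= n ->; case: cf H => q [[ls c] rs] /= ->.
by case: b; rewrite eqxx ?orbT.
Qed.

Lemma halted_later (cf : config sweepTM) b t1 t2 : t1 <= t2 ->
  (iter t1 step cf).1 = inr (Some (Some b)) ->
  (iter t2 step cf).1 = inr (Some (Some b)).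
Proof. by move=> Hle H; rewrite -(subnK Hle) iterD (halted_iter _ H). Qed.

(** On a word of length [s] a round costs [2s + 1] steps, and the deciding sweep, which halts
    without returning, [s + 1]. Sweeps preserve the length, so one bound serves every round. *)
Lemma sweeps_to_halt n w b : sweeps_to delta s0 verdict n w b ->
  forall c cs tail, tail = [::] \/ tail = [:: None] -> w = map letter_of (c :: cs) ->
  (iter (n.+1 * (2 * size w + 1)) step
     (inr None : tm_state sweepTM, scan [::] (c :: cs) tail)).1 = inr (Some (Some b)).
Proof.
elim=> {n w b} [w b Hv|n w s w' b Hm Hv _ IH] c cs tail Ht Hw.
  rewrite Hw in Hv; apply: halted_later (steps_end Ht Hv).
  by rewrite Hw size_map /=; lia.
have Hs := size_mealy delta s0 w; rewrite Hm /= in Hs.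
rewrite Hw in Hm; case: w' => [|g w'] in Hm IH Hs *; first by rewrite Hw in Hs.
have -> : n.+2 * (2 * size w + 1) =
  n.+1 * (2 * size (g :: w') + 1) + (2 * size cs + 3).
  by rewrite Hs Hw /= size_map; lia.
rewrite iterD (steps_round Ht Hm Hv) IH //; first by right.
by rewrite /= -map_comp map_id_in.
Qed.

Lemma sweepTM_halts n w b t : w != [::] ->
  sweeps_to delta s0 verdict n (map emb w) b ->
  n.+1 * (2 * size w + 1) <= t ->
  state_after sweepTM w t = inr (Some (Some b)).
Proof.
case: w => // x w _ Hsw Ht; apply: halted_later Ht _.
have := sweeps_to_halt Hsw (c := inl x) (cs := map inl w) (tail := [::]).
rewrite /= size_map -!map_comp cats0 => -> //; by left.
Qed.

End SweepTM.

(** * Evaluating a circuit by sweeps *)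

Lemma insub_bseqE n T (s : seq T) : size s <= n -> insub_bseq n s = s :> seq T.
Proof. by move=> Hs; apply: (insubdK (sT := n.-bseq T) [bseq] Hs). Qed.

(** * Alphabet and finite state set of the evaluator *)

Section Alphabet.
Variables (m K : nat) (W : finType).

(* [None]: variable; [Some None]: constant; [Some (Some j)]: operation [j]. *)
Definition opcode := option (option 'I_m).

(* [Raw] letters are input bits not yet rewritten. [One], [Zero] are the digits of
   the numeral of a pending argument; once resolved its last cell holds [Val]. The
   two output numerals stay [Raw] and are resolved to [Out]. *)
Inductive letter :=
| Raw of bool
| Junk
| One
| Zero
| Val of W
| Out of W
| Op of opcode.

Definition letter_code (l : letter) : bool + option bool + (W + W) + opcode :=
  match l with
  | Raw b => inl (inl (inl b))
  | Junk => inl (inl (inr None))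
  | One => inl (inl (inr (Some true)))
  | Zero => inl (inl (inr (Some false)))
  | Val w => inl (inr (inl w))
  | Out w => inl (inr (inr w))
  | Op o => inr o
  end.

Definition letter_decode c : letter :=
  match c with
  | inl (inl (inl b)) => Raw b
  | inl (inl (inr None)) => Junk
  | inl (inl (inr (Some true))) => One
  | inl (inl (inr (Some false))) => Zero
  | inl (inr (inl w)) => Val w
  | inl (inr (inr w)) => Out w
  | inr o => Op o
  end.

Lemma letter_codeK : cancel letter_code letter_decode.
Proof. by case=> [[]| | | | | |]. Qed.

HB.instance Definition _ := Finite.copy letter (can_type letter_codeK).

(** Every sweep starts in [HeadFresh]. [HeadSeen] to [MarkBits] serve the marking sweeps, [FindOp]
    to [Broadcast] the evaluating ones; the last sweep uses [FindOp], [GotOut] and [Verdict]. *)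
Inductive state :=
| HeadFresh
| HeadSeen
| FindRaw
| Tag1
| Tag2
| OpIndex of 'I_m.+1
| SkipCount of 'I_K.+1
| MarkArgs of 'I_K.+1
| MarkBits of 'I_K.+1
| FindOp
| Gather of opcode & K.-bseq W
| Broadcast of W & bool
| GotOut of W
| Verdict of bool.

Definition state_code (s : state) :
  (option bool * bool + 'I_m.+1) + (option bool * 'I_K.+1) +
  (opcode * K.-bseq W + W * bool) + (W + bool) :=
  match s with
  | HeadFresh => inl (inl (inl (inl (None, true))))
  | HeadSeen => inl (inl (inl (inl (None, false))))
  | FindRaw => inl (inl (inl (inl (Some true, true))))
  | Tag1 => inl (inl (inl (inl (Some true, false))))
  | Tag2 => inl (inl (inl (inl (Some false, true))))
  | FindOp => inl (inl (inl (inl (Some false, false))))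
  | OpIndex j => inl (inl (inl (inr j)))
  | SkipCount a => inl (inl (inr (None, a)))
  | MarkArgs a => inl (inl (inr (Some true, a)))
  | MarkBits a => inl (inl (inr (Some false, a)))
  | Gather o vs => inl (inr (inl (o, vs)))
  | Broadcast v b => inl (inr (inr (v, b)))
  | GotOut w => inr (inl w)
  | Verdict b => inr (inr b)
  end.

Definition state_decode c : state :=
  match c with
  | inl (inl (inl (inl (None, true)))) => HeadFresh
  | inl (inl (inl (inl (None, false)))) => HeadSeen
  | inl (inl (inl (inl (Some true, true)))) => FindRaw
  | inl (inl (inl (inl (Some true, false)))) => Tag1
  | inl (inl (inl (inl (Some false, true)))) => Tag2
  | inl (inl (inl (inl (Some false, false)))) => FindOp
  | inl (inl (inl (inr j))) => OpIndex j
  | inl (inl (inr (None, a))) => SkipCount a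
  | inl (inl (inr (Some true, a))) => MarkArgs a
  | inl (inl (inr (Some false, a))) => MarkBits a
  | inl (inr (inl (o, vs))) => Gather o vs
  | inl (inr (inr (v, b))) => Broadcast v b
  | inr (inl w) => GotOut w
  | inr (inr b) => Verdict b
  end.

Lemma state_codeK : cancel state_code state_decode.
Proof. by case. Qed.

HB.instance Definition _ := Finite.copy state (can_type state_codeK).

End Alphabet.

Arguments Raw {m W} _.
Arguments Junk {m W}.
Arguments One {m W}.
Arguments Zero {m W}.
Arguments Val {m W} _.
Arguments Out {m W} _.
Arguments Op {m W} _.
Arguments HeadFresh {m K W}.
Arguments HeadSeen {m K W}.
Arguments FindRaw {m K W}.
Arguments Tag1 {m K W}.
Arguments Tag2 {m K W}.
Arguments OpIndex {m K W} _.
Arguments SkipCount {m K W} _.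
Arguments MarkArgs {m K W} _.
Arguments MarkBits {m K W} _.
Arguments FindOp {m K W}.
Arguments Gather {m K W} _ _.
Arguments Broadcast {m K W} _ _.
Arguments GotOut {m K W} _.
Arguments Verdict {m K W} _.

Section Evaluator.
Variables (k m K : nat) (ar : 'I_m -> nat) (W : finType).
Variables (bitsem : bool -> W) (codesem : opcode m -> seq W -> W).
Variable decide : W -> W -> bool.

Local Notation letter := (letter m W).
Local Notation state := (state m K W).

(* The flag says that no digit of the current numeral has been met yet: the first
   one is erased, and a numeral without digits refers to the node of value [v]. *)
Definition broadcast (v : W) (fresh : bool) (l : letter) : state * letter :=
  match l with
  | One | Raw true => (Broadcast v false, if fresh then Junk else l)
  | Zero => (Broadcast v true, if fresh then Val v else l)
  | Raw false => (Broadcast v true, if fresh then Out v else l)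
  | _ => (Broadcast v fresh, l)
  end.

(** A [Raw true] left in the header selects a marking sweep; otherwise the sweep evaluates. A
    variable passes through [SkipCount ord0]: its index is erased like the argument count of an
    operation. *)
Definition delta (s : state) (l : letter) : state * letter :=
  match s with
  | HeadFresh =>
      match l with
      | Raw true => (HeadSeen, Junk)
      | Raw false => (FindOp, l)
      | _ => (s, l)
      end
  | HeadSeen => if l is Raw false then (FindRaw, l) else (s, l)
  | FindRaw =>
      match l with
      | Raw true => (Tag1, Junk)
      | Raw false => (SkipCount ord0, Op None)
      | _ => (s, l)
      end
  | Tag1 =>
      if l is Raw true then (Tag2, Junk) else (MarkBits (inord k), Op (Some None))
  | Tag2 => (OpIndex ord0, Junk)
  | OpIndex j =>
      if l is Raw true then (OpIndex (inord j.+1), Junk)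
      else if insub (j : nat) is Some j'
           then (SkipCount (inord (ar j')), Op (Some (Some j'))) else (s, l)
  | SkipCount a => if l is Raw true then (s, Junk) else (MarkArgs a, Junk)
  | MarkArgs a =>
      match nat_of_ord a, l with
      | _.+1, Raw true => (s, One)
      | a'.+1, Raw false => (MarkArgs (inord a'), Zero)
      | _, _ => (s, l)
      end
  | MarkBits a =>
      match nat_of_ord a, l with
      | a'.+1, Raw b => (MarkBits (inord a'), Val (bitsem b))
      | _, _ => (s, l)
      end
  | FindOp =>
      match l with
      | Op o => (Gather o [bseq], Junk)
      | Out w => (GotOut w, l)
      | _ => (s, l)
      end
  | Gather o vs =>
      match l with
      | Junk => (s, l)
      | Val w => (Gather o (insub_bseq K (rcons vs w)), Junk)
      | _ => broadcast (codesem o vs) true l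
      end
  | Broadcast v fresh => broadcast v fresh l
  | GotOut w => if l is Out w' then (Verdict (decide w w'), l) else (s, l)
  | Verdict b => (s, l)
  end.

Definition verdict (s : state) : option bool :=
  if s is Verdict b then Some b else None.

Local Notation run := (mealy delta).

Lemma run_copy s w : (forall x, x \in w -> delta s x = (s, x)) -> run s w = (s, w).
Proof.
elim: w => //= x w IH H; rewrite H ?mem_head // IH // => y Hy.
by rewrite H // inE Hy orbT.
Qed.

Variable v : nat -> W.

(** A reference to node [q] once the nodes below [t] have been broadcast. Its width stays [q + 1],
    and the digits left count the broadcasts to let pass. *)
Definition argword (t q : nat) : seq letter :=
  if q < t then rcons (nseq q Junk) (Val (v q))
  else nseq t Junk ++ rcons (nseq (q - t) One) Zero.

Definition outword (t q : nat) : seq letter :=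
  if q < t then rcons (nseq q Junk) (Out (v q))
  else nseq t Junk ++ rcons (nseq (q - t) (Raw true)) (Raw false).

Definition nodeword (t : nat) (nd : node k m) : seq letter :=
  match nd with
  | NVar i => Op None :: nseq i.+1 Junk
  | NConst d => [:: Junk, Op (Some None) & [seq Val (bitsem (d i)) | i <- enum 'I_k]]
  | NOp j args => nseq (3 + j) Junk ++ Op (Some (Some j)) ::
      nseq (size args).+1 Junk ++ flatten [seq argword t q | q <- args]
  end.

(** The index of a variable is dropped because a constant assignment gives all variables the same
    value. *)
Definition nodesem (nd : node k m) : W :=
  match nd with
  | NVar i => codesem None [::]
  | NConst d => codesem (Some None) [seq bitsem (d i) | i <- enum 'I_k]
  | NOp j args => codesem (Some (Some j)) (map v args)
  end.

Lemma run_flatten (T : Type) s (f g : T -> seq letter) xs :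
  (forall x, run s (f x) = (s, g x)) ->
  run s (flatten (map f xs)) = (s, flatten (map g xs)).
Proof. by move=> H; elim: xs => //= x xs IH; apply: mealy_cat (H x) IH. Qed.

Hypothesis (k_le : k <= K) (ar_le : forall j, ar j <= K).

(** * Marking a single node *)

Lemma run_markargs args (a : 'I_K.+1) : nat_of_ord a = size args ->
  run (MarkArgs a) (map Raw (flatten (map enc_nat args))) =
  (MarkArgs ord0, flatten (map (argword 0) args)).
Proof.
elim: args a => [|q args IH] a /= Ha.
  by congr (MarkArgs _, _); apply: val_inj.
rewrite map_cat; apply: (@mealy_cat _ _ _ _ (MarkArgs (inord (size args)))); last first.
  by apply: IH; rewrite inordK //; have := ltn_ord a; lia.
rewrite /argword /= subn0 /enc_nat map_rcons map_nseq -!cats1.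
by apply: mealy_nseq_cat => /=; rewrite Ha.
Qed.

Lemma run_markbits bs (a : 'I_K.+1) : nat_of_ord a = size bs ->
  run (MarkBits a) (map Raw bs) = (MarkBits ord0, map (Val \o bitsem) bs).
Proof.
elim: bs a => [|b bs IH] a /= Ha.
  by congr (MarkBits _, _); apply: val_inj.
rewrite {1}Ha IH // inordK //; have := ltn_ord a; lia.
Qed.

Lemma run_opindex (i n : nat) : i + n <= m ->
  run (OpIndex (inord i)) (nseq n (Raw true)) = (OpIndex (inord (i + n)), nseq n Junk).
Proof.
elim: n i => [|n IH] i Hi /=; first by rewrite addn0.
by rewrite inordK ?IH ?addSnnS //; lia.
Qed.

Lemma run_skipcount (a : 'I_K.+1) n :
  run (SkipCount a) (map Raw (enc_nat n)) = (MarkArgs a, nseq n.+1 Junk).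
Proof.
rewrite /enc_nat map_rcons map_nseq -[n.+1]addn1 nseqD -cats1.
by apply: mealy_nseq_cat.
Qed.

(** The states with an exhausted counter; they leave everything to the right of the node just marked
    unchanged. *)
Definition inert (s : state) := s = MarkArgs ord0 \/ s = MarkBits ord0.

Lemma run_inert s w : inert s -> run s w = (s, w).
Proof. by move=> [] ->; apply: run_copy. Qed.

Definition arity_ok (nd : node k m) :=
  if nd is NOp j args then size args == ar j else true.

(** The counter is loaded with [ar j], not with the encoded argument count, so [arity_ok] is what
    makes marking stop at the end of the node. *)
Lemma run_marknode nd : arity_ok nd ->
  exists2 s, inert s & run FindRaw (map Raw (enc_node nd)) = (s, nodeword 0 nd).
Proof.
case: nd => [i|d|j args] /=.
- move=> _; exists (MarkArgs ord0); first by left.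
  by rewrite run_skipcount.
- move=> _; exists (MarkBits ord0); first by right.
  rewrite run_markbits; last by rewrite inordK // size_map size_enum_ord.
  by rewrite /enc_elt -map_comp.
move=> /eqP Hs; exists (MarkArgs ord0); first by left.
rewrite !map_cat {1}/enc_nat map_rcons map_nseq cat_rcons.
have -> : OpIndex ord0 = OpIndex (inord 0) :> state.
  by congr OpIndex; apply: val_inj; rewrite /= inordK.
rewrite (mealy_cat (run_opindex (i := 0) (n := j) _)
  (s2 := MarkArgs ord0) (v' := Op (Some (Some j)) ::
      nseq (size args).+1 Junk ++ flatten [seq argword 0 q | q <- args])) //.
  by have := ltn_ord j; lia.
apply: (mealy_cons (s1 := SkipCount (inord (ar j)))).
  rewrite /= add0n inordK; last by have := ltn_ord j; lia.
  by rewrite valK.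
apply: mealy_cat (run_skipcount _ _) _.
by apply: run_markargs; rewrite inordK // ltnS.
Qed.

Lemma run_findraw_marked nd : run FindRaw (nodeword 0 nd) = (FindRaw, nodeword 0 nd).
Proof.
apply: run_copy => x; case: nd => [i|d|j args] /=.
- by rewrite !inE => /or3P[/eqP->|/eqP->|/nseqP[-> _]].
- by rewrite !inE => /or3P[/eqP->|/eqP->|/mapP[i _ ->]].
rewrite !inE mem_cat => /or4P[/eqP->|/eqP->|/eqP->|] //.
case/orP=> [/nseqP[-> _] //|]; rewrite !inE mem_cat => /or3P[/eqP->|/eqP->|] //.
case/orP=> [/nseqP[-> _] //|/flatten_mapP[q _]].
by rewrite /argword /= mem_rcons inE => /orP[/eqP->|/nseqP[-> _]].
Qed.

(** * Evaluating a single node and broadcasting its value *)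

Lemma broadcast_arg t q :
  run (Broadcast (v t) true) (argword t q) = (Broadcast (v t) true, argword t.+1 q).
Proof.
rewrite /argword ltnS; case: (ltngtP q t) => Hq.
- by rewrite -cats1; apply: mealy_nseq_cat.
(* A pending numeral loses its first digit, which lowers the flag; its terminator raises the flag
   again for the next numeral. *)
- have [n ->] : exists n, q = t + n.+1 by exists (q - t).-1; lia.
  have [-> ->] : t + n.+1 - t = n.+1 /\ t + n.+1 - t.+1 = n by lia.
  rewrite -[t.+1]addn1 nseqD -catA -!cats1.
  apply: mealy_nseq_cat => //.
  apply: (mealy_cons (s1 := Broadcast (v t) false)) => //.
  exact: mealy_nseq_cat.
by rewrite Hq subnn -!cats1; apply: mealy_nseq_cat.
Qed.

Lemma broadcast_out t q :
  run (Broadcast (v t) true) (outword t q) = (Broadcast (v t) true, outword t.+1 q).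
Proof.
rewrite /outword ltnS; case: (ltngtP q t) => Hq.
- by rewrite -cats1; apply: mealy_nseq_cat.
- have [n ->] : exists n, q = t + n.+1 by exists (q - t).-1; lia.
  have [-> ->] : t + n.+1 - t = n.+1 /\ t + n.+1 - t.+1 = n by lia.
  rewrite -[t.+1]addn1 nseqD -catA -!cats1.
  apply: mealy_nseq_cat => //.
  apply: (mealy_cons (s1 := Broadcast (v t) false)) => //.
  exact: mealy_nseq_cat.
by rewrite Hq subnn -!cats1; apply: mealy_nseq_cat.
Qed.

Lemma broadcast_node t nd :
  run (Broadcast (v t) true) (nodeword t nd) = (Broadcast (v t) true, nodeword t.+1 nd).
Proof.
case: nd => [i|d|j args].
- by apply: run_copy => x; rewrite /= !inE => /or3P[/eqP->|/eqP->|/nseqP[-> _]].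
- by apply: run_copy => x; rewrite /= !inE => /or3P[/eqP->|/eqP->|/mapP[i _ ->]].
apply: mealy_nseq_cat => //; apply: mealy_cons => //.
apply: mealy_nseq_cat => //.
exact/run_flatten/broadcast_arg.
Qed.

(** Operand lists have no end marker: gathering stops at the first letter that is neither [Junk] nor
    [Val]. The text after a node must supply one before any [Val]. *)
Fixpoint starts (w : seq letter) : bool :=
  match w with
  | [::] => false
  | Val _ :: _ => false
  | Junk :: w' => starts w'
  | _ => true
  end.

Lemma starts_junk n w : starts (nseq n Junk ++ w) = starts w.
Proof. by elim: n. Qed.

Lemma run_gather_end o vs w : starts w ->
  run (Gather o vs) w = run (Broadcast (codesem o vs) true) w.
Proof. by elim: w => // -[b| | | |u|u|o'] w IH //= /IH ->. Qed.

Lemma starts_outword t q w : starts (outword t q ++ w).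
Proof.
rewrite /outword; case: ltnP => _; first by rewrite -cats1 -catA starts_junk.
by rewrite -catA starts_junk; case: (q - t).
Qed.

Lemma starts_nodes t nds w : starts w -> starts (flatten (map (nodeword t) nds) ++ w).
Proof. by case: nds => [|[i|d|j args] nds] //= _; rewrite -!catA starts_junk. Qed.

Lemma run_gather_vals o (us : seq W) (vs : K.-bseq W) : size vs + size us <= K ->
  exists2 ws : K.-bseq W, ws = vs ++ us :> seq W &
  run (Gather o vs) (map Val us) = (Gather o ws, nseq (size us) Junk).
Proof.
elim: us vs => [|u us IH] vs /= Hs; first by exists vs; rewrite ?cats0.
have Hr : insub_bseq K (rcons vs u) = rcons vs u :> seq W.
  by rewrite insub_bseqE // size_rcons; lia.
have [|ws Hw Hm] := IH (insub_bseq K (rcons vs u)).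
  by rewrite Hr size_rcons; lia.
by exists ws; [rewrite Hw Hr cat_rcons | rewrite Hm].
Qed.

Lemma run_gather_args o t args (vs : K.-bseq W) : size vs + size args <= K ->
  all (fun q => q < t) args ->
  exists2 ws : K.-bseq W, ws = vs ++ map v args :> seq W &
  exists a, run (Gather o vs) (flatten (map (argword t) args)) = (Gather o ws, nseq a Junk).
Proof.
elim: args vs => [|q args IH] vs /=.
  by move=> _ _; exists vs; rewrite ?cats0 //; exists 0.
move=> Hs /andP[Hq Ha].
have Hr : insub_bseq K (rcons vs (v q)) = rcons vs (v q) :> seq W.
  by rewrite insub_bseqE // size_rcons; lia.
have [|//|ws Hw [a Hm]] := IH (insub_bseq K (rcons vs (v q))).
  by rewrite Hr size_rcons; lia.
exists ws; first by rewrite Hw Hr cat_rcons.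
exists (q + 1 + a); rewrite nseqD; apply: mealy_cat Hm.
by rewrite /argword Hq nseqD -cats1; apply: mealy_nseq_cat.
Qed.

(** All arguments precede [t], so each reference has already become a [Val]; gathering collects
    these values and erases the node. *)
Lemma run_evalnode t nd :
  arity_ok nd -> (if nd is NOp _ args then all (fun q => q < t) args else true) ->
  exists o, exists2 vs : K.-bseq W, codesem o vs = nodesem nd &
  exists a, run FindOp (nodeword t nd) = (Gather o vs, nseq a Junk).
Proof.
case: nd => [i|d|j args].
- move=> _ _; exists None, [bseq] => //; exists i.+2.
  by rewrite /= (mealy_nseq (s := Gather None _) (y := Junk)).
- move=> _ _; have [|vs Hvs Hm] :=
    @run_gather_vals (Some None) [seq bitsem (d i) | i <- enum 'I_k] [bseq].
    by rewrite size_map size_enum_ord.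
  exists (Some None), vs; first by rewrite Hvs.
  by exists k.+2; rewrite /= (map_comp Val (fun i => bitsem (d i))) Hm size_map size_enum_ord.
move=> /eqP Hs Ha.
have [|//|vs Hvs [a Hm]] := @run_gather_args (Some (Some j)) t args [bseq].
  by rewrite Hs; apply: ar_le.
exists (Some (Some j)), vs; first by rewrite Hvs.
exists (3 + j + (1 + ((size args).+1 + a))).
rewrite /nodeword; move: (3 + j) (size args).+1 => n1 n2; rewrite !nseqD.
apply: mealy_nseq_cat => //.
apply: (mealy_cons (s1 := Gather (Some (Some j)) [bseq])) => //.
exact: mealy_nseq_cat Hm.
Qed.

(** * Sweeps over the whole circuit *)

Section Circuit.
Variable C : circuit k m.
Local Notation N := (size (c_nodes C)).
Local Notation nodeC := (nth (NVar k m 0) (c_nodes C)).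

Definition marking (t : nat) : seq letter :=
  nseq t Junk ++ nseq (N - t) (Raw true) ++
  Raw false :: flatten (map (nodeword 0) (take t (c_nodes C))) ++
  map Raw (flatten (map (@enc_node k m) (drop t (c_nodes C)))) ++
  outword 0 (c_out1 C) ++ outword 0 (c_out2 C).

Definition evaluating (t a : nat) : seq letter :=
  nseq N Junk ++ Raw false :: nseq a Junk ++
  flatten (map (nodeword t) (drop t (c_nodes C))) ++
  outword t (c_out1 C) ++ outword t (c_out2 C).

Hypothesis arityC : forall p, p < N -> arity_ok (nodeC p).

Lemma run_marking t : t < N ->
  exists2 s, inert s & run HeadFresh (marking t) = (s, marking t.+1).
Proof.
move=> Ht; have [s Hs Hm] := run_marknode (arityC Ht); exists s => //.
rewrite /marking (drop_nth (NVar k m 0) Ht) (take_nth (NVar k m 0) Ht).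
rewrite map_rcons flatten_rcons -[t.+1]addn1 nseqD /= map_cat -!catA.
apply: mealy_nseq_cat => //.
have -> : N - t = (N - (t + 1)).+1 by lia.
apply: (mealy_cons (s1 := HeadSeen)) => //.
apply: mealy_nseq_cat => //.
apply: (mealy_cons (s1 := FindRaw)) => //.
apply: mealy_cat; first exact/run_flatten/run_findraw_marked.
by apply: mealy_cat Hm _; apply: run_inert.
Qed.

Hypothesis v_spec : forall p, p < N -> v p = nodesem (nodeC p).
Hypothesis orderC : forall p, p < N ->
  if nodeC p is NOp _ args then all (fun q => q < p) args else true.

Lemma run_evaluating t a : t < N ->
  exists b, run HeadFresh (evaluating t a) = (Broadcast (v t) true, evaluating t.+1 b).
Proof.
move=> Ht; have [o [vs Hv [b Hm]]] := run_evalnode (arityC Ht) (orderC Ht).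
exists (a + b); rewrite /evaluating (drop_nth (NVar k m 0) Ht) /= nseqD -!catA.
apply: mealy_nseq_cat => //.
apply: (mealy_cons (s1 := FindOp)) => //.
apply: mealy_nseq_cat => //.
apply: mealy_cat Hm _.
rewrite run_gather_end; last by apply/starts_nodes/starts_outword.
rewrite Hv -v_spec //.
apply: mealy_cat; first exact/run_flatten/broadcast_node.
by apply: mealy_cat; apply: broadcast_out.
Qed.

Hypotheses (out1C : c_out1 C < N) (out2C : c_out2 C < N).
Local Notation answer := (decide (v (c_out1 C)) (v (c_out2 C))).

(** All nodes being erased, [FindOp] meets no [Op] and runs on to the two [Out] letters. *)
Lemma run_verdict a : (run HeadFresh (evaluating N a)).1 = Verdict answer.
Proof.
suff : exists w, run HeadFresh (evaluating N a) = (Verdict answer, w) by case=> w ->.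
eexists; rewrite /evaluating drop_size /outword out1C out2C -!cats1 -!catA.
apply: mealy_nseq_cat => //.
apply: (mealy_cons (s1 := FindOp)) => //.
apply: mealy_nseq_cat => //.
apply: mealy_nseq_cat => //.
apply: (mealy_cons (s1 := GotOut (v (c_out1 C)))) => //.
by apply: mealy_nseq_cat.
Qed.

Lemma sweeps_evaluating n t a : t + n = N ->
  sweeps_to delta HeadFresh verdict n (evaluating t a) answer.
Proof.
elim: n t a => [|n IH] t a.
  by rewrite addn0 => ->; apply: Sweeps_end; rewrite run_verdict.
move=> Ht; have [|b Hb] := @run_evaluating t a; first by lia.
by apply: Sweeps_next Hb _ (IH _ _ _) => //; lia.
Qed.

Lemma sweeps_marking n t : t + n = N ->
  sweeps_to delta HeadFresh verdict (n + N) (marking t) answer.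
Proof.
elim: n t => [|n IH] t.
  (* After [N] marking sweeps the header digits are spent, which is the signal to evaluate. *)
  rewrite addn0 => ->; have -> : marking N = evaluating 0 0.
    by rewrite /marking /evaluating subnn take_size drop_size drop0.
  exact: sweeps_evaluating.
move=> Ht; have [|s Hs Hm] := @run_marking t; first by lia.
apply: Sweeps_next Hm _ (IH _ _); last by lia.
by case: Hs => ->.
Qed.

Lemma sweeps_circuit :
  sweeps_to delta HeadFresh verdict (N + N) (map Raw (enc_circuit C)) answer.
Proof.
have -> : map Raw (enc_circuit C) = marking 0.
  rewrite /marking /enc_circuit /outword !map_cat /= !subn0 drop0 take0 /=.
  by rewrite /enc_nat !map_rcons !map_nseq cat_rcons.
exact: sweeps_marking.
Qed.

End Circuit.
End Evaluator.

(** * Monotone circuits *)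

Definition monotone (n : nat) (f : ('I_n -> bool) -> bool) :=
  forall x y, (forall i, x i ==> y i) -> f x ==> f y.

Lemma lattice_poly_monotone n f : @is_poly _ _ lat_ops n f -> monotone f.
Proof.
move=> [t Ht] x y Hxy; rewrite -!{}Ht.
elim: t => [i|b|j args IH] /=; [exact: Hxy | exact: implybb |].
have := IH ord0; have := IH (lift ord0 ord0); rewrite /lat_ops.
by case: ifP => _; do 4!case: (peval _ _ _).
Qed.

(** A fundamental operation applied to the variables is a polynomial, hence by the equivalence a
    lattice polynomial. *)
Lemma poly_equiv_lattice_monotone m (ar : 'I_m -> nat) (ops : bool_ops ar) j :
  poly_equiv_lattice ops -> monotone (ops j).
Proof.
move=> H; apply/lattice_poly_monotone/H.
by exists (POp (fun l => PVar ar l)).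
Qed.

(** A function on ['I_n -> bool] need not a priori respect pointwise equality; a monotone one does,
    by antisymmetry of the order on [bool]. *)
Lemma monotone_ext n f x y : @monotone n f -> (forall i, x i = y i) -> f x = f y.
Proof.
move=> Hf Hxy; have /implyP Hl : f x ==> f y by apply: Hf => i; rewrite Hxy implybb.
have /implyP Hr : f y ==> f x by apply: Hf => i; rewrite Hxy implybb.
exact/idP/idP.
Qed.

Section Circuits.
Variables (k m : nat) (ar : 'I_m -> nat) (A : 'I_k -> bool_ops ar).
Variable D : {set {ffun 'I_k -> bool}}.
Hypothesis monoA : forall i j, monotone (@A i j).
Local Notation elt := {ffun 'I_k -> bool}.

Section Values.
Variable C : circuit k m.
Hypothesis wfC : circuit_wf ar D C.
Local Notation N := (size (c_nodes C)).
Local Notation nodeC := (nth (NVar k m 0) (c_nodes C)).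

Definition nodeval (a : nat -> elt) (p : nat) : elt :=
  nth (dflt k) (node_values A a C) p.

Lemma node_wfC p : p < N -> node_wf ar D N p (nodeC p).
Proof.
by case/and3P: wfC => /allP H _ _ Hp; apply: H; rewrite mem_iota add0n.
Qed.

Lemma nodevalE a p : p < N ->
  nodeval a p =
  match nodeC p with
  | NVar i => a i
  | NConst d => d
  | NOp j args => prod_op A j (fun l => nodeval a (nth 0 args l))
  end.
Proof.
move=> Hp; rewrite /nodeval /node_values.
pose vals nds := foldl (fun vs nd => rcons vs (eval_node A a vs nd)) [::] nds.
have vals_rcons nds nd : vals (rcons nds nd) = rcons (vals nds) (eval_node A a (vals nds) nd).
  by rewrite /vals -cats1 foldl_cat.
have size_vals nds : size (vals nds) = size nds.
  by elim/last_ind: nds => // nds nd IH; rewrite vals_rcons !size_rcons IH.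
(* Values are only appended, so later nodes leave earlier entries unchanged. *)
have nth_vals_cat us ws q : q < size us ->
    nth (dflt k) (vals (us ++ ws)) q = nth (dflt k) (vals us) q.
  move=> Hq; elim/last_ind: ws => [|ws nd IH]; first by rewrite cats0.
  by rewrite -rcons_cat vals_rcons nth_rcons size_vals size_cat ltn_addr.
have size_take_p : size (take p (c_nodes C)) = p by rewrite size_take Hp.
have nth_lt q : q < p -> nth (dflt k) (vals (c_nodes C)) q =
    nth (dflt k) (vals (take p (c_nodes C))) q.
  by move=> Hq; rewrite -{1}(cat_take_drop p (c_nodes C)) nth_vals_cat ?size_take_p.
rewrite -/(vals (c_nodes C)).
rewrite -{1}(cat_take_drop p.+1 (c_nodes C)) nth_vals_cat; last first.
  by rewrite size_take_min; lia.
rewrite (take_nth (NVar k m 0) Hp) vals_rcons nth_rcons size_vals size_take_p ltnn eqxx.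
have := node_wfC Hp; case: (nodeC p) => [i|d|j args] //= /andP[/eqP Hs /allP Ha].
apply/ffunP => i; rewrite !ffunE; apply: monotone_ext => // l.
by rewrite nth_lt //; apply/Ha/mem_nth; rewrite Hs.
Qed.

Lemma nodeval_closed a p : subdirect A D -> (forall x, a x \in D) -> p < N ->
  nodeval a p \in D.
Proof.
move=> [_ closedD _] Ha; elim/ltn_ind: p => p IH Hp; rewrite nodevalE //.
have := node_wfC Hp; case: (nodeC p) => [i|d|j args] //= /andP[/eqP Hs /allP Hargs].
apply: closedD => l; have Hl : nth 0 args l < p by apply/Hargs/mem_nth; rewrite Hs.
by apply: IH => //; apply: ltn_trans Hp.
Qed.

Lemma nodeval_monotone (a b : nat -> elt) i p : (forall x, a x i ==> b x i) -> p < N ->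
  nodeval a p i ==> nodeval b p i.
Proof.
move=> Hab; elim/ltn_ind: p => p IH Hp; rewrite !nodevalE //.
have := node_wfC Hp; case: (nodeC p) => [x|d|j args] //=; first by rewrite implybb.
move=> /andP[/eqP Hs /allP Hargs]; rewrite !ffunE; apply: monoA => l.
have Hl : nth 0 args l < p by apply/Hargs/mem_nth; rewrite Hs.
by apply: IH => //; apply: ltn_trans Hp.
Qed.

Lemma out_lt : c_out1 C < N /\ c_out2 C < N.
Proof. by case/and3P: wfC. Qed.

(* A common output value [d] of a solution can be substituted for every variable:
   where [d] is [true] the constant assignment [d] lies above the solution, and where
   it is [false] below, so by monotonicity both outputs are again [d]. *)
Lemma csat_yesP : subdirect A D ->
  reflect (csat_yes A D C)
    [exists d in D, nodeval (fun=> d) (c_out1 C) == nodeval (fun=> d) (c_out2 C)].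
Proof.
move=> sdD; have [lt1 lt2] := out_lt.
apply: (iffP exists_inP) => [[d Hd /eqP Heq]|[a [Ha Heq]]]; first by exists (fun=> d).
rewrite -!/(nodeval _ _) in Heq; set d := nodeval a (c_out1 C) in Heq.
exists d; first exact: nodeval_closed.
suff fixd p : p < N -> nodeval a p = d -> nodeval (fun=> d) p = d.
  by rewrite !fixd.
move=> Hp Hpd; apply/ffunP => i; case Hdi: (d i).
  have le_ad (x : nat) : a x i ==> d i by rewrite Hdi implybT.
  by have := nodeval_monotone (b := fun=> d) le_ad Hp; rewrite Hpd Hdi.
have le_da (x : nat) : d i ==> a x i by rewrite Hdi.
by have := nodeval_monotone (a := fun=> d) le_da Hp; rewrite Hpd Hdi implybF => /negbTE.
Qed.

Definition fanin (nd : node k m) : nat := if nd is NOp _ args then size args else 0.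

(** Well-formedness bounds variable indices and references by [N], so despite unary numerals each
    node and each argument costs linearly many bits. *)
Lemma size_enc_circuit : size (enc_circuit C) <= (m + k + 9) * (csize C).+1 ^ 2.
Proof.
have size_enc_nat n : size (enc_nat n) = n.+1 by rewrite size_rcons size_nseq.
(* [X] bounds the fixed part of a node code, and also the cost of an argument: at most [N] cells,
   plus one digit in the argument count. *)
have [X defX] : {X | X = N + m + k + 5} by exists (N + m + k + 5).
have Hnode p : p < N -> size (enc_node (nodeC p)) <= X + fanin (nodeC p) * X.
  move=> Hp; have := node_wfC Hp; case: (nodeC p) => [i|d|j args] /=.
  - by rewrite size_enc_nat => Hi; lia.
  - by rewrite size_map size_enum_ord => _; lia.
  move=> /andP[_ Hargs]; rewrite !size_cat !size_enc_nat.
  suff : size (flatten [seq enc_nat q | q <- args]) <= size args * N.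
    have : size args * N.+1 <= size args * X by apply: leq_mul => //; lia.
    by rewrite mulnS => HX Hflat; have Hj := ltn_ord j; lia.
  elim: args Hargs => //= q args IH /andP[Hq /IH].
  by rewrite size_cat size_enc_nat; nia.
have Hnodes : size (flatten (map (@enc_node k m) (c_nodes C))) <=
    N * X + sumn (map fanin (c_nodes C)) * X.
  have: all (fun nd => size (enc_node nd) <= X + fanin nd * X) (c_nodes C).
    by apply/(all_nthP (NVar k m 0)).
  elim: (c_nodes C) => //= nd nds IH /andP[Hnd /IH].
  by rewrite size_cat; nia.
have [lt1 lt2] := out_lt.
rewrite /enc_circuit !size_cat !size_enc_nat /csize.
move: Hnodes; rewrite -mulnDl -/fanin defX -mulnn.
move: (sumn _) (size (flatten _)) => e L.
nia.
Qed.

Local Notation W := {ffun elt -> elt}.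

(* The evaluator handles all constant assignments [fun=> d] at once: the value of a
   node is the table of its values under these assignments. *)
Definition table_bit (b : bool) : W := [ffun _ => [ffun _ => b]].

(** A constant arrives as [k] bit tables, gathered like operands, the [i]-th supplying coordinate
    [i]. *)
Definition table_op (o : opcode m) (vs : seq W) : W :=
  let arg l d := nth [ffun _ => dflt k] vs l d in
  match o with
  | None => [ffun d => d]
  | Some None => [ffun d => [ffun i : 'I_k => arg i d i]]
  | Some (Some j) => [ffun d => prod_op A j (fun l => arg l d)]
  end.

Definition table_decide (w1 w2 : W) : bool := [exists d in D, w1 d == w2 d].

Definition table (p : nat) : W := [ffun d => nodeval (fun=> d) p].

Lemma tableE p : p < N -> table p = nodesem table_bit table_op table (nodeC p).
Proof.
move=> Hp; apply/ffunP => d; rewrite ffunE nodevalE //.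
have := node_wfC Hp; case: (nodeC p) => [x|c|j args] /=.
- by rewrite ffunE.
- move=> _; apply/ffunP => i; rewrite !ffunE (nth_map i) ?size_enum_ord //.
  by rewrite nth_ord_enum !ffunE.
move=> /andP[/eqP Hs _]; rewrite ffunE; apply/ffunP => i; rewrite !ffunE.
apply: monotone_ext => // l.
by rewrite (nth_map 0) ?Hs // ffunE.
Qed.

End Values.
End Circuits.

Theorem theorem9p3 (k m : nat) (ar : 'I_m -> nat) (A : 'I_k -> bool_ops ar)
  (D : {set {ffun 'I_k -> bool}}) :
  (forall i : 'I_k, poly_equiv_lattice (A i)) ->
  subdirect A D ->
  CSAT_in_P A D.
Proof.
move=> latA sdD.
have monoA i j : monotone (A i j) by apply: poly_equiv_lattice_monotone.
(* [K] bounds what one node gathers: the [k] bits of a constant or the [ar j] arguments of an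
   operation. *)
pose K := maxn k (\max_j ar j).
have k_le : k <= K by apply: leq_maxl.
have ar_le j : ar j <= K by apply: leq_trans (leq_maxr _ _); apply: leq_bigmax.
pose W := {ffun {ffun 'I_k -> bool} -> {ffun 'I_k -> bool}}.
pose M := @sweepTM (state m K W) (letter m W)
  (delta k ar (@table_bit k) (table_op A) (table_decide D)) HeadFresh Raw
  (@verdict m K W).
(* With [s] the circuit size plus one, there are at most [2s] sweeps of at most
   [(2(m + k + 9) + 1) s^2] steps each. *)
exists M, (2 * (2 * (m + k + 9) + 1)), 3; split=> // C wfC t.
have Ht : (size (c_nodes C) + size (c_nodes C)).+1 * (2 * size (enc_circuit C) + 1) <= t.
  have := size_enc_circuit wfC; rewrite /t /csize.
  set n := size (c_nodes C); set e := sumn _; set L := size (enc_circuit C) => HL.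
  apply: (@leq_trans ((2 * (n + e).+1) *
    ((2 * (m + k + 9) + 1) * (n + e).+1 ^ 2))).
    by apply: leq_mul; lia.
  by rewrite expnS; lia.
(* On a blank first cell the machine would idle forever; the terminator of the header numeral
   excludes this. *)
have nz : enc_circuit C != [::] by rewrite /enc_circuit /enc_nat; case: (size _).
have [lt1 lt2] := out_lt wfC.
have arityC p : p < size (c_nodes C) ->
    arity_ok ar (nth (NVar k m 0) (c_nodes C) p).
  by move=> /(node_wfC wfC); case: (nth _ _ _) => //= j args /andP[].
have orderC p : p < size (c_nodes C) ->
    if nth (NVar k m 0) (c_nodes C) p is NOp _ args then all (fun q => q < p) args else true.
  by move=> /(node_wfC wfC); case: (nth _ _ _) => //= j args /andP[].
have Hsw := sweeps_circuit (table_decide D) k_le ar_le arityC (tableE monoA wfC) orderC lt1 lt2.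
have Hst := sweepTM_halts nz Hsw Ht.
have Hdec : table_decide D (table A C (c_out1 C)) (table A C (c_out2 C)) =
  [exists d in D, nodeval A C (fun=> d) (c_out1 C) == nodeval A C (fun=> d) (c_out2 C)].
  by apply: eq_existsb => d; rewrite !ffunE.
rewrite /accepts_within /rejects_within -/M in Hst *; rewrite {}Hst Hdec.
by split; case: (csat_yesP monoA wfC sdD).
Qed.
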